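(* There exist infinitely many strong Eulerian triples, i.e., infinitely many sets $\{x_1,x_2,x_3\}$ of three distinct rational numbers such that $x_1x_2+x_1+x_2$, $x_1x_3+x_1+x_3$, $x_2x_3+x_2+x_3$, $x_1^2+2x_1$, $x_2^2+2x_2$ and $x_3^2+2x_3$ are all squares of rational numbers. *)

(* Defs.v *)
From mathcomp Require Import all_boot all_order all_algebra finmap.
From mathcomp Require Import boolp classical_sets functions cardinality.

Set Implicit Arguments.
Unset Strict Implicit.
Unset Printing Implicit Defensive.

Import GRing.Theory.
Local Open Scope ring_scope.

Definition is_rat_square (q : rat) : Prop := exists r : rat, q = r ^+ 2.

Definition strong_eulerian_triple (A : {fset rat}) : Prop :=
  exists x1 x2 x3 : rat,
    [/\ A = [fset x1; x2; x3]%fset,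
        [/\ x1 <> x2, x1 <> x3 & x2 <> x3],
        [/\ is_rat_square (x1 * x2 + x1 + x2),
            is_rat_square (x1 * x3 + x1 + x3)
          & is_rat_square (x2 * x3 + x2 + x3)]
      & [/\ is_rat_square (x1 ^+ 2 + 2 * x1),
            is_rat_square (x2 ^+ 2 + 2 * x2)
          & is_rat_square (x3 ^+ 2 + 2 * x3)]].

(* Main.v *)
Require Import Defs.
From mathcomp Require Import all_boot all_order all_algebra finmap.
From mathcomp Require Import boolp classical_sets functions cardinality.
From mathcomp Require Import ring lra.

(** With [x_i = a_i - 1] the conditions say that all [a_i a_j - 1] and
    [a_i ^ 2 - 1] are squares. Take [a_1 = 1], [a_2 = 1 + r^2],
    [a_3 = 1 + s^2]; it remains that [r^2 + 2], [s^2 + 2] and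
    [r^2 s^2 + r^2 + s^2] are squares. For fixed [r] with [r^2 + 2] a square,
    the last two conditions cut out a curve of genus 1 in [s] which has the
    trivial point [s = r], lying above a point [P] of
    [y^2 = x (x + r^2) (x + 2 (r^2 + 1))], [x = (r^2 + 1) s^2]. The point [3 P]
    lifts to the same curve and gives
    [s = r (r^4 - 2 r^2 - 7) / (3 r^4 + 6 r^2 - 1)], valid for every [r] on the
    conic [r^2 + 2 = w^2]. *)

Local Open Scope classical_set_scope.

Import Order.TTheory GRing.Theory Num.Theory.
Local Open Scope ring_scope.

Definition euler_s (r : rat) : rat :=
  r * (r ^+ 4 - 2 * r ^+ 2 - 7) / (3 * r ^+ 4 + 6 * r ^+ 2 - 1).

Definition euler_set (r : rat) : {fset rat} :=
  [fset 0; r ^+ 2; euler_s r ^+ 2]%fset.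

Lemma euler_s_add2 (r : rat) : 3 * r ^+ 4 + 6 * r ^+ 2 - 1 != 0 ->
  euler_s r ^+ 2 + 2 =
  (r ^+ 2 + 2) * ((r ^+ 4 + 6 * r ^+ 2 + 1) / (3 * r ^+ 4 + 6 * r ^+ 2 - 1)) ^+ 2.
Proof. by move=> D0; rewrite /euler_s; field. Qed.

Lemma euler_s_mixed (r : rat) : 3 * r ^+ 4 + 6 * r ^+ 2 - 1 != 0 ->
  r ^+ 2 * euler_s r ^+ 2 + r ^+ 2 + euler_s r ^+ 2 =
  (r ^+ 2 + 2) *
    (r * (r ^+ 4 + 2 * r ^+ 2 + 5) / (3 * r ^+ 4 + 6 * r ^+ 2 - 1)) ^+ 2.
Proof. by move=> D0; rewrite /euler_s; field. Qed.

(** These bounds make [0], [euler_s r ^+ 2] and [r ^+ 2] distinct, with [r ^+ 2] the largest, so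
    that the set determines [r]. *)
Lemma euler_s_bounds (r : rat) : 4 <= r -> 0 < euler_s r < r.
Proof.
move=> r4; have r0 : 0 < r by lra.
have q16 : 16 <= r ^+ 2 by nra.
have N0 : 0 < r ^+ 4 - 2 * r ^+ 2 - 7.
  rewrite (_ : r ^+ 4 = r ^+ 2 * r ^+ 2); last by ring.
  by nra.
have ND : r ^+ 4 - 2 * r ^+ 2 - 7 < 3 * r ^+ 4 + 6 * r ^+ 2 - 1 by lra.
have D0 := lt_trans N0 ND.
by rewrite /euler_s divr_gt0 ?mulr_gt0//= ltr_pdivrMr// ltr_pM2l.
Qed.

Lemma euler_set_strong (r w : rat) : 4 <= r -> r ^+ 2 + 2 = w ^+ 2 ->
  strong_eulerian_triple (euler_set r).
Proof.
move=> r4 hw; have /andP[s0 sr] := euler_s_bounds r r4.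
have r0 : 0 < r by lra.
have D0 : 3 * r ^+ 4 + 6 * r ^+ 2 - 1 != 0.
  have : 0 <= r ^+ 4 by rewrite exprn_ge0// ltW.
  have : 16 <= r ^+ 2 by nra.
  by move=> ? ?; apply: lt0r_neq0; lra.
have := euler_s_mixed r D0; have := euler_s_add2 r D0.
(* The factor [r ^+ 2 + 2] common to both identities becomes the square [w ^+ 2]. *)
rewrite hw /euler_set.
set s := euler_s r in s0 sr *; move=> hs hrs.
exists 0, (r ^+ 2), (s ^+ 2); split=> //.
- by split=> h; nra.
- split; [exists r; ring | exists s; ring | by eexists; rewrite hrs -exprMn].
- split; [exists 0; ring | exists (r * w) | ].
    by rewrite [RHS]exprMn -hw; ring.
  exists (s * (w * ((r ^+ 4 + 6 * r ^+ 2 + 1) / (3 * r ^+ 4 + 6 * r ^+ 2 - 1)))).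
  by rewrite [RHS]exprMn [(w * _) ^+ 2]exprMn -hs; ring.
Qed.

Lemma euler_set_le (r r' : rat) : 4 <= r -> 4 <= r' ->
  euler_set r = euler_set r' -> r <= r'.
Proof.
move=> r4 r'4 e; have /andP[s0 sr] := euler_s_bounds r' r'4.
have : r ^+ 2 \in euler_set r' by rewrite -e !inE eqxx orbT.
by rewrite !inE => /orP[/orP[]|] /eqP h; nra.
Qed.

(** Solves [(w - r) * (w + r) = 2] with [w + r = n + 10] and [w - r = 2 / (n + 10)]; the shift by 10
    ensures [4 <= r]. *)
Definition conic_r (n : nat) : rat :=
  ((n%:R + 10) ^+ 2 - 2) / (2 * (n%:R + 10)).

Lemma conic_rP (n : nat) :
  conic_r n ^+ 2 + 2 = (((n%:R + 10) ^+ 2 + 2) / (2 * (n%:R + 10))) ^+ 2.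
Proof.
have n0 : n%:R + 10 != 0 :> rat by rewrite lt0r_neq0// ltr_wpDl.
by rewrite /conic_r; field.
Qed.

Lemma conic_r_ge4 (n : nat) : 4 <= conic_r n.
Proof.
have n0 : 0 <= n%:R :> rat by [].
rewrite /conic_r ler_pdivlMr; last by lra.
by nra.
Qed.

Lemma conic_r_inj : injective conic_r.
Proof.
move=> m n; rewrite /conic_r => /eqP.
have m0 : 0 <= m%:R :> rat by [].
have n0 : 0 <= n%:R :> rat by [].
rewrite eqr_div; [|by apply: lt0r_neq0; lra ..].
move=> /eqP e; apply/eqP; rewrite -(eqr_nat rat); apply/eqP.
set a := m%:R in m0 e *; set b := n%:R in n0 e *.
(* Half the difference of the cross-multiplied sides factors; the second factor is positive since
   [a] and [b] are nonnegative. *)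
have : (a - b) * ((a + 10) * (b + 10) + 2) = 0 by lra.
move=> /eqP; rewrite mulf_eq0 => /orP[/eqP|/eqP]; first by lra.
by nra.
Qed.

Theorem theorem1p1 : infinite_set [set A : {fset rat} | strong_eulerian_triple A].
Proof.
have sub : range (euler_set \o conic_r) `<=` [set A | strong_eulerian_triple A].
  by move=> _ [n _ <-]; exact: euler_set_strong (conic_r_ge4 n) (conic_rP n).
apply: sub_infinite_set sub _; apply/infiniteP.
rewrite (card_le_eqr (inj_card_eq _)) //.
move=> m n _ _ /= e; apply/conic_r_inj/le_anti/andP.
have m4 := conic_r_ge4 m; have n4 := conic_r_ge4 n.
by split; apply: euler_set_le.
Qed.
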